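(* Let $p=1$ and consider the zero range process in one of the following cases, with $\beta,\mathfrak a>0$: (case 2) $I=\mathbb Z^+=\{0,1,2,\dots\}$, $g(y)=\mathfrak a\,(1-e^{-\beta y})$; (case 3) $I=\mathbb Z^+$, $g(y)=\mathfrak a\,(e^{\beta y}-1)$; (case 4) $I=\mathbb Z$, $g(y)=\mathfrak a\,e^{\beta y}+\mathfrak b$ with $\mathfrak b\ge 0$. Let $\underline m=(m_i)_{i\in\mathbb Z}$ have non-negative integer components and let $\underline\sigma=(\sigma_i)_{i\in\mathbb Z}$ be real numbers with $\underline\theta<\sigma_i<\bar\theta$ for all $i$ (that is, $\sigma_i<\ln\mathfrak a$ in case 2, no restriction in case 3, and $\sigma_i>\ln\mathfrak b$ in case 4, with $\ln 0=-\infty$). Suppose that for all $i\in\mathbb Z$ $$\sigma_{i-1}-\sigma_i=\begin{cases}-\beta m_i&\text{(case 2)},\\ \beta m_i&\text{(cases 3, 4)},\end{cases}\qquad\text{and that}\qquad \hat\mu^{\sigma,m}=\mu^\sigma\ \text{ for all admissible }\sigma\text{ and all } m.$$ Then the measure $\underline\nu^{\underline\sigma,\underline m}$ satisfies the random walking shocks property with $$\sigma_j^{i,i+1}=\begin{cases}\sigma_j,&j\ne i,\\ \sigma_i-\beta,&j=i\ \text{(case 2)},\\ \sigma_i+\beta,&j=i\ \text{(cases 3, 4)},\end{cases}$$ $$Q(m_i,m_{i+1},\sigma_i,\sigma_{i+1})=0,\qquad P(m_i,m_{i+1},\sigma_i,\sigma_{i+1})=\begin{cases}(1-e^{-\beta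 m_i})(\mathfrak a-e^{\sigma_i}),&\text{case 2},\\ (e^{\beta m_i}-1)(e^{\sigma_i}+\mathfrak a),&\text{case 3},\\ (e^{\beta m_i}-1)(e^{\sigma_i}-\mathfrak b),&\text{case 4}.\end{cases}$$
   Context: **Zero range process (totally asymmetric).** $I$ is the set of possible occupation numbers of a site, and a particle jumps from site $i$ to $i+1$ with rate $g(\omega_i)$. For a vector $\underline\omega$ indexed by $\mathbb Z$, $\underline\omega^{i,j}$ has $(\underline\omega^{i,j})_i=\omega_i-1$, $(\underline\omega^{i,j})_j=\omega_j+1$, and all other coordinates unchanged; $\underline m^{i,i+1}$ and $\underline m^{i+1,i}$ are defined the same way. **Stationary marginals.** Define $g(0)!=1$, $g(z)!=\prod_{y=1}^z g(y)$ for $z>0$, and $g(z)!=1/\prod_{y=z+1}^0 g(y)$ for $z<0$. Put $\bar\theta=\lim_{z\to\infty}\ln g(z)$, and $\underline\theta=\lim_{z\to-\infty}\ln g(z)$ if $I=\mathbb Z$, $\underline\theta=-\infty$ if $I=\mathbb Z^+$. For $\underline\theta<\theta<\bar\theta$, $\mu^\theta$ is the probability measure on $I$ given by $\mu^\theta(z)=\frac{1}{Z(\theta)}\frac{e^{\theta z}}{g(z)!}$, $Z(\theta)=\sum_{z\in I}\frac{e^{\theta z}}{g(z)!}$. **Coupled dynamics.** On pairs $(\underline\omega,\underline\zeta)$ with $\omega_i\le\zeta_i$ for all $i$, the (basic coupling) generator for $p=1$ is $$(L\varphi)(\underline\omega,\underline\zeta)=\sum_{i\in\mathbb Z}\Big\{g(\omega_i)\big[\varphi(\underline\omega^{i,i+1},\underline\zeta^{i,i+1})-\varphi(\underline\omega,\underline\zeta)\big]+[g(\zeta_i)-g(\omega_i)]\big[\varphi(\underline\omega,\underline\zeta^{i,i+1})-\varphi(\underline\omega,\underline\zeta)\big]\Big\}.$$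 There are $\zeta_i-\omega_i$ second class particles at site $i$. $S(t)$ denotes the corresponding evolution (semigroup). **Multiple shock measure.** For $\underline\theta<\sigma<\bar\theta$ and an integer $m\ge 0$, let $\hat\mu^{\sigma,m}$ be a probability measure on $I$ with $\hat\mu^{\sigma,0}=\mu^\sigma$, and let $\nu^{\sigma,m}$ be the probability measure on $I\times I$ with $\nu^{\sigma,m}(y,z)=\hat\mu^{\sigma,m}(y)$ if $z=y+m$ and $0$ otherwise. Then $\underline\nu^{\underline\sigma,\underline m}=\bigotimes_{i\in\mathbb Z}\nu^{\sigma_i,m_i}$ is the product measure for the pairs $(\omega_i,\zeta_i)$, with exactly $m_i$ second class particles at site $i$. **Random walking shocks property.** With non-negative $P$, $Q$ and with modified parameter vectors $\underline\sigma^{i,i+1}$, $\underline\sigma^{i+1,i}$, $$\begin{aligned}\frac{d}{dt}\underline\nu^{\underline\sigma,\underline m}S(t)\Big|_{t=0}=\sum_{i\in\mathbb Z}\Big\{&P(m_i,m_{i+1},\sigma_i,\sigma_{i+1})\big[\underline\nu^{\underline\sigma^{i,i+1},\underline m^{i,i+1}}-\underline\nu^{\underline\sigma,\underline m}\big]\\+&Q(m_i,m_{i+1},\sigma_i,\sigma_{i+1})\big[\underline\nu^{\underline\sigma^{i+1,i},\underline m^{i+1,i}}-\underline\nu^{\underline\sigma,\underline m}\big]\Big\}.\end{aligned}$$ Terms with coefficient $0$ are read as zero (in particular those $P$-terms with $m_i=0$, and all $Q$-terms when $Q=0$, so $\underline\sigma^{i+1,i}$ then need not be specified). The identity is understood through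 the generator: for every bounded function $\varphi$ depending on finitely many sites, $\int L\varphi\,d\underline\nu^{\underline\sigma,\underline m}$ equals the right-hand side integrated against $\varphi$ (only finitely many terms of the sum are then non-zero). *)

(* Defs.v *)
From HB Require Import structures.
From mathcomp Require Import all_boot all_order all_algebra.
From mathcomp Require Import all_classical all_reals all_analysis.
From mathcomp Require Import measurable_realfun.
Set Implicit Arguments.
Unset Strict Implicit.
Unset Printing Implicit Defensive.
Import Order.TTheory GRing.Theory Num.Theory.
Import numFieldNormedType.Exports.
Local Open Scope classical_set_scope.
Local Open Scope ring_scope.

HB.instance Definition _ := isPointed.Build int 0%R.

Definition coordinate_events : set (set (int -> int * int)) :=
  [set C | exists i x, C = [set eta | eta i = x]].

(* Pairs of integer vectors [fun i => (w i, z i)], with the product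
   sigma-algebra. *)
Definition config := g_sigma_algebraType coordinate_events.
HB.instance Definition _ := Measurable.on config.

Definition is_pmf {R : realType} {T : choiceType} (I : set T) (p : T -> R) :=
  [/\ forall z, 0 <= p z, forall z, ~ I z -> p z = 0 &
      (\esum_(z in I) (p z)%:E = 1)%E].

(* [nu] is the product over the sites of the laws with mass functions [p i]: the
   finite cylinders below determine a measure on the product sigma-algebra. *)
Definition is_product_measure {R : realType} (p : int -> int * int -> R)
    (nu : probability config R) :=
  forall (F : seq int) (x : int -> int * int), uniq F ->
    nu [set eta | forall i, i \in F -> eta i = x i] =
    (\prod_(i <- F) p i (x i))%:E.

(* A uniform variable on [0, 1[ is expanded into independent digits: the digit
   [cell_index q u] has mass function [q], and [rescale q u] is again uniform and
   independent of it. *)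
Module ProductMeasureExistence.

Section inverse_cdf.
Context {R : realType}.
Implicit Types (q : nat -> R) (u : R).

Definition partial_mass q n : R := \sum_(k < n) q k.
Definition cell_index q u : nat := xget 0%N [set n | partial_mass q n <= u < partial_mass q n.+1].
Definition rescale q u : R := (u - partial_mass q (cell_index q u)) / q (cell_index q u).
Definition mass_seq q := (forall n, 0 <= q n) /\ (partial_mass q n @[n --> \oo] --> (1 : R)).

Variable q : nat -> R.
Hypothesis qP : mass_seq q.

Lemma partial_mass_nd : {homo partial_mass q : m n / (m <= n)%N >-> m <= n}.
Proof.
apply/nondecreasing_seqP => n; rewrite /partial_mass big_ord_recr/= lerDl; exact: qP.1.
Qed.

Lemma partial_mass_le1 n : partial_mass q n <= 1.
Proof.
have := @nondecreasing_cvgn_le R (partial_mass q) partial_mass_nd _ n.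
rewrite (cvg_lim _ qP.2)//; apply; exact: qP.2.
Qed.

Lemma partial_mass_ge0 n : 0 <= partial_mass q n.
Proof. by apply: sumr_ge0 => i _; exact: qP.1. Qed.

Lemma cell_indexP u n : 0 <= u < 1 -> (cell_index q u = n) <-> (partial_mass q n <= u < partial_mass q n.+1).
Proof.
move=> /andP[u0 u1].
have uniq : forall m k, partial_mass q m <= u < partial_mass q m.+1 -> partial_mass q k <= u < partial_mass q k.+1 -> m = k.
  suff H : forall m k, (m < k)%N -> partial_mass q m <= u < partial_mass q m.+1 ->
      partial_mass q k <= u < partial_mass q k.+1 -> False.
    move=> m k Hm Hk; case: (ltngtP m k) => // mk.
      by case: (H _ _ mk Hm Hk).
    by case: (H _ _ mk Hk Hm).
  move=> m k mk /andP[_ Hm] /andP[Hk _].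
  by have := lt_le_trans Hm (le_trans (partial_mass_nd mk) Hk); rewrite ltxx.
have [k Hk] : exists k, partial_mass q k <= u < partial_mass q k.+1.
  have ex : exists n, u < partial_mass q n.
    have /cvgrPdist_lt /(_ (1 - u)) := qP.2.
    rewrite subr_gt0 => /(_ u1)[N _ /(_ N (leqnn N))]/=.
    rewrite ger0_norm ?subr_ge0 ?partial_mass_le1// => h; exists N.
    by rewrite -(ltrN2) -(ltrD2l 1).
  case: (ex_minnP ex) => -[|k]; first by rewrite /partial_mass big_ord0 ltNge u0.
  move=> Hk Hmin; exists k; rewrite Hk andbT leNgt; apply/negP => /Hmin.
  by rewrite ltnn.
rewrite /cell_index; split=> [<-|Hn].
- by case: xgetP => [m -> //|/(_ k)]; rewrite /= Hk.
- case: xgetP => [m _ Hm|/(_ n)]; first exact: uniq.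
  by rewrite /= Hn.
Qed.

Lemma cell_index_out u : ~~ (0 <= u < 1) -> cell_index q u = 0%N.
Proof.
move=> Hu; rewrite /cell_index; case: xgetP => // m _ /= /andP[H1 H2]; exfalso.
move/negP: Hu; apply; rewrite (le_trans (partial_mass_ge0 _) H1)/=.
exact: lt_le_trans H2 (partial_mass_le1 _).
Qed.

Lemma cell_index_cell n :
  cell_index q @^-1` [set n] `&` `[0, 1[ = [set` `[partial_mass q n, partial_mass q n.+1[].
Proof.
apply/seteqP; split=> u /=; rewrite !in_itv/=.
- by move=> [H Hu]; apply/cell_indexP.
- move=> H; have Hu : 0 <= u < 1.
    case/andP: H => H1 H2; rewrite (le_trans (partial_mass_ge0 _) H1)/=.
    exact: lt_le_trans H2 (partial_mass_le1 _).
  by split => //; apply/cell_indexP.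
Qed.

Lemma measurable_cell_index : measurable_fun [set: R] (cell_index q).
Proof.
move=> _ A _; rewrite setTI.
have -> : cell_index q @^-1` A = \bigcup_(n in A) (cell_index q @^-1` [set n]).
  by apply/seteqP; split=> u /=; [exists (cell_index q u)|case=> n An /= ->].
apply: bigcup_measurable => n _.
have -> : cell_index q @^-1` [set n] = [set` `[partial_mass q n, partial_mass q n.+1[] `|`
    (if n == 0%N then ~` `[0, 1[ else set0).
  rewrite -cell_index_cell; apply/seteqP; split => u /=.
  - move=> Hn; case: (boolP (u \in `[0,1[)) => Hu; [by left|right].
    rewrite in_itv/= in Hu.
    by rewrite -Hn (cell_index_out Hu)/= in_itv/=; apply/negP.
  - case=> [[]//|]; case: eqP => // -> /=.
    by move/negP; rewrite in_itv/= => /cell_index_out.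
apply: measurableU; first exact: measurable_itv.
case: eqP => // _; apply: measurableC; exact: measurable_itv.
Qed.

Lemma measurable_rescale : measurable_fun [set: R] (rescale q).
Proof.
move=> _ B mB; rewrite setTI.
have -> : rescale q @^-1` B = \bigcup_n (cell_index q @^-1` [set n] `&`
    ((fun u => (u - partial_mass q n) / q n) @^-1` B)).
  by apply/seteqP; split=> u /=; [exists (cell_index q u)|case=> n _ [/= <-]].
apply: bigcup_measurable => n _; apply: measurableI.
  by rewrite -[X in measurable X]setTI; exact: measurable_cell_index.
rewrite -[X in measurable X]setTI.
apply: (_ : measurable_fun _ _) => //.
by apply: measurable_funM => //; apply: measurable_funB.
Qed.

Definition leb01 : set (measurableTypeR R) -> \bar R :=
  mrestr lebesgue_measure (@measurable_itv R `[0, 1[).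
HB.instance Definition _ := Measure.on leb01.

Lemma lebesgue_affine (s c : R) (B : set R) : 0 < c -> measurable B ->
  (lebesgue_measure ((fun u : R => ((u - s) / c)%R) @^-1` B) = c%:E * lebesgue_measure B)%E.
Proof.
move=> c0 mB; pose f u : R := (u - s) / c.
have mf : measurable_fun [set: measurableTypeR R] (f : _ -> measurableTypeR R).
  by apply: measurable_funM => //; apply: measurable_funB.
have ci : 0 <= c^-1 by rewrite invr_ge0 ltW.
pose mu := [the {measure set (measurableTypeR R) -> \bar R} of
  mscale (NngNum ci) (measure_function_pushforward__canonical__measure_function_Measure
    (@lebesgue_measure R) mf)].
have -> : lebesgue_measure B = mu B.
  apply: lebesgue_measure_unique => // _ [[a b]/= _ <-].
  rewrite /mu/= /mscale/= /pushforward/=.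
  have -> : f @^-1` `]a, b] = `](s + c * a), (s + c * b)]%classic.
    apply/seteqP; split=> x /=; rewrite !in_itv/= /f ltr_pdivlMr// ler_pdivrMr//;
    by rewrite ltrBrDl lerBlDl (mulrC c) (mulrC c).
  rewrite !lebesgue_measure_itv/= !lte_fin ltrD2l ltr_pM2l//.
  case: ifPn => _; last by rewrite mule0.
  rewrite -!EFinD -EFinM; congr (_%:E).
  by rewrite opprD addrACA subrr add0r -mulrBr mulrA mulVf ?gt_eqF// mul1r.
rewrite /mu/= /mscale/= muleA -EFinM divff ?gt_eqF// mul1e.
by [].
Qed.

Lemma leb01_cell n (B : set R) : measurable B ->
  leb01 (cell_index q @^-1` [set n] `&` rescale q @^-1` B) = ((q n)%:E * leb01 B)%E.
Proof.
move=> mB; rewrite /leb01 /mrestr.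
have -> : cell_index q @^-1` [set n] `&` rescale q @^-1` B `&` `[0, 1[ =
    [set` `[partial_mass q n, partial_mass q n.+1[] `&` (fun u => (u - partial_mass q n) / q n) @^-1` B.
  rewrite setIAC cell_index_cell; apply/seteqP; split=> u /= [Hu].
    move: (Hu); rewrite -[X in X -> _]/([set` `[partial_mass q n, partial_mass q n.+1[] u).
    by rewrite -cell_index_cell /rescale => -[/= -> _].
  move: (Hu); rewrite -[X in X -> _]/([set` `[partial_mass q n, partial_mass q n.+1[] u).
  by rewrite -cell_index_cell /rescale => -[/= -> _].
have Sn : partial_mass q n.+1 = partial_mass q n + q n by rewrite /partial_mass big_ord_recr.
have := qP.1 n; rewrite le_eqVlt => /predU1P[qn0|qn].
  rewrite -qn0 mul0e Sn -qn0 addr0 (_ : [set` `[_, _[] = set0) ?set0I ?measure0//.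
  by rewrite set_itvco0.
rewrite -(lebesgue_affine (partial_mass q n) qn); last first.
  by apply: measurableI => //; exact: measurable_itv.
congr (lebesgue_measure _); rewrite preimage_setI setIC; congr (_ `&` _).
apply/seteqP; split=> u /=; rewrite !in_itv/= ler_pdivlMr// ltr_pdivrMr// mul0r mul1r subr_ge0 ltrBlDl Sn//.
Qed.

Lemma leb01_rescale (B : set R) : measurable B ->
  leb01 (rescale q @^-1` B) = leb01 B.
Proof.
move=> mB.
have -> : rescale q @^-1` B = \bigcup_n (cell_index q @^-1` [set n] `&` rescale q @^-1` B).
  by apply/seteqP; split=> u /=; [exists (cell_index q u)|case=> n _ []].
have mS : measurable (rescale q @^-1` B).
  by rewrite -[X in measurable X]setTI; exact: measurable_rescale.
have mC n : measurable (cell_index q @^-1` [set n] `&` rescale q @^-1` B).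
  by apply: measurableI => //; rewrite -[X in measurable X]setTI; exact: measurable_cell_index.
rewrite measure_semi_bigcup//; last first.
- by apply: bigcup_measurable => i _; exact: mC.
- by apply/trivIsetP => i j _ _ /eqP ij; rewrite -subset0 => u [[/= hi _] [/= hj _]]; apply: ij; rewrite -hi.
rewrite (eq_eseriesr (fun n _ => leb01_cell n mB)) -[RHS]mul1e.
under eq_eseriesr do rewrite muleC.
have lf : (leb01 B < +oo)%E.
  apply: (@le_lt_trans _ _ (lebesgue_measure (`[0%R, 1%R[%classic : set R))).
    rewrite /leb01 /mrestr; apply: le_measure; rewrite ?inE.
    - by apply: measurableI => //; exact: measurable_itv.
    - exact: measurable_itv.
    - by apply: subIsetr.
  by rewrite lebesgue_measure_itv/= lte_fin ltr01 ltry.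
have fB : leb01 B \is a fin_num by rewrite ge0_fin_numE.
rewrite -(fineK fB) nneseriesZl//; last by move=> n _; rewrite lee_fin; exact: qP.1.
rewrite muleC; congr (_ * _)%E.
apply/cvg_lim => //.
rewrite (_ : (fun n => _) = (fun n => (partial_mass q n)%:E)).
  by apply: cvg_EFin; [exact: nearW|exact: qP.2].
by apply/funext => n; rewrite sumEFin /partial_mass big_mkord.
Qed.

End inverse_cdf.

Section coordinates.
Context {R : realType} (q : nat -> nat -> R).
Hypothesis qP : forall k, mass_seq (q k).

Fixpoint iter_rescale n (u : R) : R := if n is k.+1 then rescale (q k) (iter_rescale k u) else u.

Lemma measurable_iter_rescale n : measurable_fun [set: R] (iter_rescale n).
Proof.
elim: n => [|n IH]; first exact: measurable_id.
exact: (measurableT_comp (measurable_rescale (qP n)) IH).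
Qed.

Definition symbol k u : nat := cell_index (q k) (iter_rescale k u).

Lemma measurable_symbol k : measurable_fun [set: R] (symbol k).
Proof. exact: (measurableT_comp (measurable_cell_index (qP k)) (measurable_iter_rescale k)). Qed.

Lemma leb01_symbol (F : pred nat) (x : nat -> nat) n (B : set R) : measurable B ->
  leb01 ([set u | forall k, (k < n)%N -> F k -> symbol k u = x k] `&` iter_rescale n @^-1` B) =
  ((\prod_(k < n | F k) q k (x k))%:E * leb01 B)%E.
Proof.
elim: n B => [|n IH] B mB.
  rewrite big_ord0 mul1e; congr leb01.
  by apply/seteqP; split=> u /=; [case|].
have mS : measurable (rescale (q n) @^-1` B).
  by rewrite -[X in measurable X]setTI; exact: measurable_rescale.
rewrite big_mkcond big_ord_recr -big_mkcond/=.
case: ifPn => Fn.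
- rewrite EFinM -muleA -leb01_cell// -IH; last first.
    apply: measurableI => //.
    by rewrite -[X in measurable X]setTI; exact: measurable_cell_index.
  congr leb01; apply/seteqP; split=> u /=.
    move=> [H Bu]; split; [by move=> k kn Fk; apply: H => //; exact: ltnW|].
    by split=> //; exact: H.
  move=> [H [/= Hn Bu]]; split=> // k; rewrite ltnS leq_eqVlt => /predU1P[-> _//|].
  exact: H.
- rewrite mulr1 -[in RHS](leb01_rescale (qP n))// -IH//.
  congr leb01; apply/seteqP; split=> u /=.
    by move=> [H Bu]; split=> // k kn Fk; apply: H => //; exact: ltnW.
  move=> [H Bu]; split=> // k; rewrite ltnS leq_eqVlt => /predU1P[-> Fn'|].
    by rewrite Fn' in Fn.
  exact: H.
Qed.

End coordinates.

Lemma bijective_nat (T : countType) : infinite_set [set: T] ->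
  exists f : T -> nat, bijective f.
Proof.
move=> infT; have /card_set_bijP[f] := eq_card_nat (countableP [set: T]) infT.
by rewrite setTT_bijective => bf; exists f.
Qed.

Lemma infinite_int : infinite_set [set: int].
Proof.
move=> fi; apply: infinite_nat.
apply: sub_finite_set (finite_image absz fi) => n _.
by exists n%:Z.
Qed.

Lemma mass_seq_pmf {R : realType} (T : choiceType) (p : T -> R) (e : nat -> T) :
  bijective e -> is_pmf setT p -> mass_seq (p \o e).
Proof.
move=> be [p0 _ p1]; split=> [n /=|]; first exact: p0.
have p0' x : setT x -> (0 <= (p x)%:E)%E by rewrite lee_fin.
move: p1; rewrite (reindex_esum setT setT e)//; last by rewrite setTT_bijective.
rewrite -nneseries_esumT => [p1|n]; last exact: p0'.
rewrite (_ : partial_mass _ = fine \o (fun n => (\sum_(0 <= i < n) (p (e i))%:E)%E)).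
  apply: fine_cvg; rewrite -p1.
  by apply: is_cvg_nneseries => n _ _; exact: p0'.
by apply/funext => n /=; rewrite sumEFin /partial_mass big_mkord.
Qed.

Lemma product_measure_exists {R : realType} (p : int -> int * int -> R) :
  (forall i, is_pmf setT (p i)) ->
  exists nu : probability config R, is_product_measure p nu.
Proof.
move=> pP.
have [a [a' aK a'K]] := bijective_nat infinite_int.
have infE : infinite_set [set: int * int].
  by rewrite -setXTT; apply: infinite_setX; exact: infinite_int.
have [e [e' eK e'K]] := bijective_nat infE.
pose q k := p (a' k) \o e'.
have qP k : mass_seq (q k) by apply: mass_seq_pmf (pP _); exists e.
pose X (u : measurableTypeR R) : config := fun i => e' (symbol q (a i) u).
have mX : measurable_fun [set: measurableTypeR R] X.
  have := @measurability _ _ (measurableTypeR R) config setT X coordinate_events. apply; [by []|].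
  move=> _ [_ [i [x ->]] <-].
  rewrite setTI (_ : _ @^-1` _ = symbol q (a i) @^-1` [set e x]).
    by rewrite -[X in measurable X]setTI; exact: measurable_symbol.
  apply/seteqP; split=> u /=; first by move<-; rewrite e'K.
  by rewrite /X => ->; rewrite eK.
pose nu := measure_function_pushforward__canonical__measure_function_Measure
  (@leb01 R) mX.
have nuT : nu setT = 1%E.
  rewrite /nu/= /pushforward preimage_setT /leb01 /mrestr setTI.
  by rewrite lebesgue_measure_itv/= lte_fin ltr01 sube0.
pose P := Measure_isProbability.Build _ _ _ nu nuT.
pose nu' : probability config R := HB.pack (nu : set config -> \bar R) nu P.
exists nu' => F x uF.
rewrite /nu' /= /pushforward.
pose n := (\max_(i <- F) a i).+1.
have aFn i : i \in F -> (a i < n)%N by move=> iF; rewrite ltnS; exact: leq_bigmax_seq.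
have := leb01_symbol qP (fun k => a' k \in F) (fun k => e (x (a' k))) n (@measurableT _ _).
rewrite preimage_setT setIT (_ : leb01 setT = 1%E) ?mule1; last first.
  by rewrite /leb01 /mrestr setTI lebesgue_measure_itv/= lte_fin ltr01 sube0.
move=> H; transitivity (leb01 [set u | forall k : nat, (k < n)%N ->
    a' k \in F -> symbol q k u = e (x (a' k))]).
  congr leb01; apply/seteqP; split=> u /= Hu.
    by move=> k kn kF; have := Hu _ kF; rewrite /X a'K => <-; rewrite e'K.
  by move=> i iF; rewrite /X Hu ?aK ?eK// aFn.
rewrite H; congr (_%:E).
rewrite -(big_mkord (fun k => a' k \in F) (fun k => q k (e (x (a' k))))) -big_filter.
rewrite (perm_big (map a F)); last first.
  apply: uniq_perm.
  - by rewrite filter_uniq// iota_uniq.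
  - by rewrite map_inj_uniq//; exact: can_inj aK.
  - move=> k; rewrite mem_filter mem_index_iota/=.
    apply/andP/mapP => [[kF _]|[i iF ->]]; first by exists (a' k); rewrite ?a'K.
    by rewrite aK iF aFn.
by rewrite big_map; apply: eq_bigr => i _; rewrite /q/= eK aK.
Qed.

End ProductMeasureExistence.

Definition product_measure {R : realType} (p : int -> int * int -> R) :
  probability config R := get (is_product_measure p).

Lemma product_measureP {R : realType} (p : int -> int * int -> R) :
  (forall i, is_pmf setT (p i)) -> is_product_measure p (product_measure p).
Proof.
by move=> /ProductMeasureExistence.product_measure_exists[nu nuP]; exact: getPex (ex_intro _ nu nuP).
Qed.

Section stationary_marginals.
Context {R : realType} (I : set int) (g : int -> R).

Definition gfact (z : int) : R :=
  match z with
  | Posz n => \prod_(1 <= y < n.+1) g y%:Z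
  | Negz n => (\prod_(0 <= k < n.+1) g (- k%:Z))^-1  (* z = - n.+1 *)
  end.

Definition theta_sup : \bar R := limn (fun n : nat => (ln (g n%:Z))%:E).

Definition theta_inf : \bar R :=
  if `[< I = setT >] then limn (fun n : nat => (ln (g (- n%:Z)))%:E) else -oo%E.

Definition admissible (t : R) : Prop := (theta_inf < t%:E < theta_sup)%E.

Definition weight (t : R) (z : int) : R := expR (t * z%:~R) / gfact z.

Definition partition_function (t : R) : R :=
  fine (\esum_(z in I) (weight t z)%:E)%E.

Definition stationary_mass (t : R) (z : int) : R :=
  if z \in I then weight t z / partition_function t else 0.

Definition shock_marginals (muhat : R -> int -> int -> R) : Prop :=
  forall t, admissible t ->
    (forall k : int, 0 <= k -> is_pmf I (muhat t k)) /\
    (forall z, muhat t 0 z = stationary_mass t z).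

End stationary_marginals.

Section shock_measure.
Context {R : realType} (muhat : R -> int -> int -> R).

Definition pair_mass (t : R) (k : int) (yz : int * int) : R :=
  if yz.2 == yz.1 + k then muhat t k yz.1 else 0.

Definition shock_measure (s : int -> R) (m : int -> int) : probability config R :=
  product_measure (fun i => pair_mass (s i) (m i)).

End shock_measure.

Definition jump (w : int -> int) (i j : int) : int -> int :=
  fun k => w k - (k == i)%:Z + (k == j)%:Z.

Definition pair_config (w z : int -> int) : config := fun k => (w k, z k).

(* The sum has finite support when [phi] depends on finitely many sites. Test
   functions live on all pairs of integer vectors; the measures considered charge
   only vectors with coordinates in [I] and [w i <= z i], and there a jump that
   leaves this set has rate 0. *)
Definition generator {R : realType} (g : int -> R) (phi : config -> R)
    (eta : config) : R :=
  let w i := (eta i).1 in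
  let z i := (eta i).2 in
  \sum_(i \in [set: int])
    (g (w i) * (phi (pair_config (jump w i (i + 1)) (jump z i (i + 1))) - phi eta) +
     (g (z i) - g (w i)) * (phi (pair_config w (jump z i (i + 1))) - phi eta)).

Definition bounded_function {R : realType} (phi : config -> R) : Prop :=
  exists M : R, forall eta, `|phi eta| <= M.

Definition finitely_dependent {R : realType} (phi : config -> R) : Prop :=
  exists F : seq int, forall eta eta' : config,
    (forall i, i \in F -> eta i = eta' i) -> phi eta = phi eta'.

(* [sr i] and [sl i] are the modified parameter vectors of the jumps from [i] to
   [i + 1] and from [i + 1] to [i]. The left-hand integral is taken in [\bar R]:
   since [oo - oo] evaluates to [-oo], its being finite includes the
   integrability of the (possibly unbounded) function [generator g phi]. *)
Definition random_walking_shocks {R : realType} (g : int -> R)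
    (nu : (int -> R) -> (int -> int) -> probability config R)
    (s : int -> R) (m : int -> int) (P Q : int -> int -> R -> R -> R)
    (sr sl : int -> int -> R) : Prop :=
  [/\ forall i, 0 <= P (m i) (m (i + 1)) (s i) (s (i + 1)),
      forall i, 0 <= Q (m i) (m (i + 1)) (s i) (s (i + 1)) &
      forall phi : config -> R, bounded_function phi -> finitely_dependent phi ->
        (\int[nu s m]_eta (generator g phi eta)%:E)%E =
        (\sum_(i \in [set: int])
          (P (m i) (m (i + 1)) (s i) (s (i + 1)) *
             ((\int[nu (sr i) (jump m i (i + 1))]_eta phi eta) -
              (\int[nu s m]_eta phi eta)) +
           Q (m i) (m (i + 1)) (s i) (s (i + 1)) *
             ((\int[nu (sl i) (jump m (i + 1) i)]_eta phi eta) -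
              (\int[nu s m]_eta phi eta))))%:E].

Inductive zrp_case := concave_exp | convex_exp | two_sided_exp.

Section zero_range_models.
Context {R : realType} (c : zrp_case) (a b beta : R).

Definition occupation : set int :=
  match c with
  | concave_exp | convex_exp => [set z | 0 <= z]
  | two_sided_exp => setT
  end.

Definition rate (y : int) : R :=
  match c with
  | concave_exp => a * (1 - expR (- (beta * y%:~R)))
  | convex_exp => a * (expR (beta * y%:~R) - 1)
  | two_sided_exp => a * expR (beta * y%:~R) + b
  end.

Definition sigma_increment (k : int) : R :=
  match c with
  | concave_exp => - (beta * k%:~R)
  | convex_exp | two_sided_exp => beta * k%:~R
  end.

Definition sigma_right (s : int -> R) (i : int) : int -> R := fun j =>
  if j == i then
    match c with
    | concave_exp => s i - beta
    | convex_exp | two_sided_exp => s i + beta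
    end
  else s j.

Definition shock_rate (mi mi1 : int) (si si1 : R) : R :=
  match c with
  | concave_exp => (1 - expR (- (beta * mi%:~R))) * (a - expR si)
  | convex_exp => (expR (beta * mi%:~R) - 1) * (expR si + a)
  | two_sided_exp => (expR (beta * mi%:~R) - 1) * (expR si - b)
  end.

End zero_range_models.

(* Main.v *)
Require Import Defs.
From mathcomp Require Import all_boot all_order all_algebra.
From mathcomp Require Import all_classical all_reals all_analysis.
From mathcomp Require Import measurable_realfun zify ring.
Set Implicit Arguments.
Unset Strict Implicit.
Unset Printing Implicit Defensive.
Import Order.TTheory GRing.Theory Num.Theory.
Import numFieldNormedType.Exports.
Local Open Scope classical_set_scope.
Local Open Scope ring_scope.

(** The particle part of the dynamics reproduces the product measure up to weights,
    since [g y * mu^t y = e^t * mu^t (y - 1)]. A second class particle leaves site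
    [i] at rate [g (y + k) - g y = K_k * h y], where [h y = a e^(+-beta y)] is both
    affine in [g y] and a change of density from [mu^t] to [mu^(t +- beta)]; its jump
    therefore moves the parameter of site [i] by [+-beta], with total rate
    [K_k * E h]. What remains of the generator telescopes over the sites into two
    boundary terms
    [e^(s_(i-1) - s_i) E(g(w_i) phi) - e^(s_(i-1)) E phi] at sites [i] which [phi]
    does not see, and these vanish by independence. *)

(** * Integrals of functions of finitely many sites as countable sums *)

Definition depends_on (T : Type) (F : seq int) (f : config -> T) : Prop :=
  forall x y : config, (forall i, i \in F -> x i = y i) -> f x = f y.

Section cylinders.
Variable F : seq int.

(* [config] is uncountable, but a function of the sites of [F] factors through the
   countable [code]. *)
Definition code (x : config) : nat := pickle (map x F).

Lemma codeP (x y : config) : code x = code y <-> forall i, i \in F -> x i = y i.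
Proof.
split=> [/(pcan_inj pickleK)/eq_in_map//|xy].
by congr pickle; exact/eq_in_map.
Qed.

Definition cell (k : nat) : set config := [set x | code x = k].

Lemma trivIset_cell : trivIset setT cell.
Proof.
by apply/trivIsetP => i j _ _ /eqP ij; rewrite -subset0 => x [/= xi xj]; apply: ij; rewrite -xi -xj.
Qed.

Lemma bigcup_cell : \bigcup_k cell k = setT.
Proof. by apply/seteqP; split=> // x _; exists (code x). Qed.

Lemma cell_code (x : config) :
  cell (code x) = [set y : config | forall i, i \in F -> y i = x i].
Proof. by apply/seteqP; split=> y /= /codeP. Qed.

Lemma measurable_cell k : measurable (cell k).
Proof.
have [[x <-]|nx] := pselect (exists x, code x = k); last first.
  rewrite (_ : cell k = set0)// -subset0 => y yk; apply: nx; by exists y.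
rewrite cell_code (_ : [set y | _] =
  \bigcap_(i in [set` F]) [set y : config | y i = x i])//.
apply: fin_bigcap_measurable => [|i _]; first exact: finite_seq.
by apply: sub_sigma_algebra; exists i, (x i).
Qed.

Lemma measurable_depends_on d (T : measurableType d) (f : config -> T) :
  depends_on F f -> measurable_fun setT f.
Proof.
move=> Ff _ Y mY; rewrite setTI.
rewrite (_ : f @^-1` Y = \bigcup_(k in code @` (f @^-1` Y)) cell k).
  by apply: bigcup_measurable => k _; exact: measurable_cell.
apply/seteqP; split=> [x Yx|x [_ [y Yy <-]]] /=; first by exists (code x) => //; exists x.
by move=> /codeP xy; rewrite (Ff _ _ xy).
Qed.

(** A set of representatives: it meets every nonempty cell in exactly one configuration, so sums
    over cells become sums over configurations, on which translations act. *)
Definition supported_on : set config := [set x | forall i, i \notin F -> x i = 0].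

Lemma code_supported_on (x : config) : exists2 y, supported_on y & code y = code x.
Proof.
exists (fun i => if i \in F then x i else 0); first by move=> i /= /negPf ->.
by apply/codeP => i ->.
Qed.

Lemma code_inj : set_inj supported_on code.
Proof.
move=> x y /set_mem Dx /set_mem Dy /codeP xy; apply/funext => i.
have [/xy//|iF] := boolP (i \in F); by rewrite Dx// Dy.
Qed.

Context {R : realType} (p : int -> int * int -> R) (nu : probability config R).
Hypotheses (nuP : is_product_measure p nu) (uF : uniq F).

(** [f] is constant on each of the countably many cells, and a nonempty cell is a cylinder whose
    measure is the finite product of one-site masses. Nonnegativity allows countable additivity
    without integrability. *)
Lemma ge0_integral_esum (f : config -> R) : depends_on F f -> (forall x, 0 <= f x) ->
  (\int[nu]_x (f x)%:E =
   \esum_(x in supported_on) (f x * \prod_(i <- F) p i (x i))%:E)%E.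
Proof.
move=> Ff f0.
have mf := measurable_depends_on Ff.
rewrite -bigcup_cell ge0_integral_bigcup//; last 4 first.
- exact: measurable_cell.
- by apply: measurable_funTS; exact/measurable_EFinP.
- by move=> x _; rewrite lee_fin.
- exact: trivIset_cell.
rewrite nneseries_esumT; last by move=> k; apply: integral_ge0 => x _; rewrite lee_fin.
transitivity (\esum_(k in code @` supported_on) \int[nu]_(x in cell k) (f x)%:E)%E.
  rewrite [RHS]esum_mkcond; apply: eq_esum => k _.
  case: ifPn => // /negP; rewrite inE => nk.
  rewrite (_ : cell k = set0) ?integral_set0// -subset0 => x xk; apply: nk.
  by have [y Dy yx] := code_supported_on x; exists y; rewrite // yx.
rewrite esum_image; last exact: code_inj.
apply: eq_esum => x _.
transitivity (\int[nu]_(_ in cell (code x)) (f x)%:E)%E.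
  by apply: eq_integral => y; rewrite inE => /codeP /Ff ->.
rewrite integral_cst; last exact: measurable_cell.
by rewrite cell_code [X in (_ * X)%E]nuP.
Qed.

End cylinders.

(** * Change of variables between product measures *)

Section transport.
Context {R : realType} (p p' : int -> int * int -> R) (nu nu' : probability config R).
Hypotheses (p0 : forall i x, 0 <= p i x) (p'0 : forall i x, 0 <= p' i x).
Hypotheses (nuP : is_product_measure p nu) (nu'P : is_product_measure p' nu').
Variables (F : seq int) (u : int -> int * int).
Hypotheses (uF : uniq F) (Fu : forall i, i \notin F -> u i = 0).

(** A particle jump adds a fixed finitely supported vector, so every jump in the generator is such a
    change of variables. *)
Definition translate (x : config) : config := fun i => x i + u i.

Lemma translate_bij : set_bij (supported_on F) (supported_on F) translate.
Proof.
split.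
- by move=> x Dx i iF; rewrite /translate Dx// Fu// addr0.
- by move=> x y _ _ xy; apply/funext => i; have /(congr1 (fun z => z i))/addIr := xy.
- move=> x Dx; exists (fun i => x i - u i); first by move=> i iF; rewrite Dx// Fu// subr0.
  by apply/funext => i; rewrite /translate subrK.
Qed.

(* Positive and negative parts are transported separately, so that [f] and [f'] need
   not be integrable. *)
Lemma integral_transport (f f' : config -> R) : depends_on F f -> depends_on F f' ->
  (forall x, f x * \prod_(i <- F) p i (x i) =
     f' (translate x) * \prod_(i <- F) p' i (translate x i)) ->
  (\int[nu]_x (f x)%:E = \int[nu']_x (f' x)%:E)%E.
Proof.
have key (h h' : config -> R) : depends_on F h -> depends_on F h' ->
    (forall x, 0 <= h x) -> (forall x, 0 <= h' x) ->
    (forall x, h x * \prod_(i <- F) p i (x i) =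
      h' (translate x) * \prod_(i <- F) p' i (translate x i)) ->
    (\int[nu]_x (h x)%:E = \int[nu']_x (h' x)%:E)%E.
  move=> Fh Fh' h0 h'0 hh'.
  rewrite (ge0_integral_esum nuP uF)// (ge0_integral_esum nu'P uF)//.
  rewrite [RHS](reindex_esum _ _ _ _ translate_bij); apply: eq_esum => x _.
  by rewrite hh'.
move=> Ff Ff' ff'.
have P0 x : 0 <= \prod_(i <- F) p i (x i) by exact: prodr_ge0.
have P'0 x : 0 <= \prod_(i <- F) p' i (x i) by exact: prodr_ge0.
rewrite integralE [RHS]integralE.
under eq_integral do rewrite funeposE -EFin_max.
under [X in (_ - X)%E]eq_integral do rewrite funenegE -EFin_max.
under [in RHS]eq_integral do rewrite funeposE -EFin_max.
under [X in (_ = _ - X)%E]eq_integral do rewrite funenegE -EFin_max.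
congr (_ - _)%E; apply: key.
- by move=> x y /Ff ->.
- by move=> x y /Ff' ->.
- by move=> x; rewrite le_max lexx orbT.
- by move=> x; rewrite le_max lexx orbT.
(* The weights are nonnegative, so multiplying by them commutes with the maximum with 0. *)
- by move=> x; rewrite !maxr_pMl// ff' !mul0r.
- by move=> x y /Ff ->.
- by move=> x y /Ff' ->.
- by move=> x; rewrite le_max lexx orbT.
- by move=> x; rewrite le_max lexx orbT.
- by move=> x; rewrite !maxr_pMl// !mulNr ff' !mul0r.
Qed.

End transport.

(** * Integrability of local functions and of their products with rates *)

Section integrability.
Context {R : realType} (nu : probability config R).

Lemma bounded_depends_integrable F (f : config -> R) :
  depends_on F f -> bounded_function f -> nu.-integrable setT (EFin \o f).
Proof.
move=> Ff [M fM].
apply: (@le_integrable _ _ _ nu setT _ _ (cst M%:E)) => //.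
- by apply/measurable_EFinP; exact: measurable_depends_on Ff.
- by move=> x _ /=; rewrite lee_fin (le_trans (fM x)) ?ler_norm.
- exact: finite_measure_integrable_cst.
Qed.

Lemma Rintegral_probability_cst (r : R) : \int[nu]_x r = r.
Proof.
transitivity (r * fine (nu setT)); first exact: Rintegral_cst.
by rewrite probability_setT mulr1.
Qed.

Lemma integrable_mul_bounded F (h f : config -> R) :
  depends_on F f -> bounded_function f -> nu.-integrable setT (EFin \o h) ->
  nu.-integrable setT (EFin \o (fun x => h x * f x)).
Proof.
move=> Ff [M fM] hi.
have := @integrableMr _ _ _ nu setT measurableT f (EFin \o h) (measurable_depends_on Ff) _ hi.
rewrite (_ : ((EFin \o f) \* (EFin \o h))%E = EFin \o (fun x => h x * f x)); last first.
  by apply/funext => x /=; rewrite mulrC EFinM.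
apply; exists M; split; first exact: num_real.
by move=> y My x _ /=; rewrite (le_trans (fM x))// ltW.
Qed.

End integrability.


Lemma translate0 x : translate (fun=> 0) x = x.
Proof. by apply/funext => i; rewrite /translate addr0. Qed.

Section transport_real.
Context {R : realType} (p p' : int -> int * int -> R) (nu nu' : probability config R).
Hypotheses (p0 : forall i x, 0 <= p i x) (p'0 : forall i x, 0 <= p' i x).
Hypotheses (nuP : is_product_measure p nu) (nu'P : is_product_measure p' nu').
Variables (F : seq int) (u : int -> int * int).
Hypotheses (uF : uniq F) (Fu : forall i, i \notin F -> u i = 0).
Variables f f' : config -> R.
Hypotheses (Ff : depends_on F f) (Ff' : depends_on F f').
Hypothesis ff' : forall x, f x * \prod_(i <- F) p i (x i) =
  f' (translate u x) * \prod_(i <- F) p' i (translate u x i).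

Lemma Rintegral_transport : \int[nu]_x f x = \int[nu']_x f' x.
Proof. by congr fine; exact: (integral_transport p0 p'0 nuP nu'P uF Fu). Qed.

(** The weights are nonnegative, so the pointwise identity survives absolute values. This gives
    integrability of unbounded rates without tail estimates, by transport to a simpler integrand. *)
Lemma integrable_transport :
  nu'.-integrable setT (EFin \o f') -> nu.-integrable setT (EFin \o f).
Proof.
move=> /integrableP[_ f'oo]; apply/integrableP; split.
  by apply/measurable_EFinP; exact: measurable_depends_on Ff.
suff -> : (\int[nu]_x `|(EFin \o f) x| = \int[nu']_x `|(EFin \o f') x|)%E by [].
apply: (integral_transport (f := fun x => `|f x|) (f' := fun x => `|f' x|) p0 p'0 nuP nu'P uF Fu).
- by move=> x y /Ff ->.
- by move=> x y /Ff' ->.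
move=> x; have P0 (q : int -> int * int -> R) (y : config) : (forall i x, 0 <= q i x) ->
    `|\prod_(i <- F) q i (y i)| = \prod_(i <- F) q i (y i).
  by move=> q0; rewrite ger0_norm// prodr_ge0.
by rewrite -(P0 p)// -(P0 p')// -!normrM ff'.
Qed.

End transport_real.

Lemma depends_on_sub (T : Type) (F G : seq int) (f : config -> T) :
  {subset F <= G} -> depends_on F f -> depends_on G f.
Proof. by move=> FG Ff x y xy; apply: Ff => i /FG /xy. Qed.

Lemma depends_on_translate (T : Type) (F : seq int) (f : config -> T) u :
  depends_on F f -> depends_on F (f \o translate u).
Proof. by move=> Ff x y xy; apply: Ff => i /xy; rewrite /translate => ->. Qed.

(** * Jumps of particles as translations *)

Section hops.
Implicit Types (w : int -> int) (x : config).

Lemma succ_neq (i : int) : (i + 1 == i) = false.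
Proof. by apply/negbTE; rewrite -subr_eq0 addrAC subrr add0r oner_eq0. Qed.

Lemma jump_src w i : jump w i (i + 1) i = w i - 1.
Proof. by rewrite /jump eqxx eq_sym succ_neq addr0. Qed.

Lemma jump_dst w i : jump w i (i + 1) (i + 1) = w (i + 1) + 1.
Proof. by rewrite /jump eqxx succ_neq subr0. Qed.

Lemma jump_other w i k : k != i -> k != i + 1 -> jump w i (i + 1) k = w k.
Proof. by rewrite /jump => /negPf -> /negPf ->; rewrite subr0 addr0. Qed.

Definition hop_both i x : config :=
  pair_config (jump (fun k => (x k).1) i (i + 1)) (jump (fun k => (x k).2) i (i + 1)).

Definition hop_second i x : config :=
  pair_config (fun k => (x k).1) (jump (fun k => (x k).2) i (i + 1)).

(** A jump adds the jump of the zero vector; this is the form to which the transport lemmas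
    apply. *)
Lemma hop_bothE i : hop_both i =
  translate (fun k => (jump (fun=> 0) i (i + 1) k, jump (fun=> 0) i (i + 1) k)).
Proof.
apply/funext => x; apply/funext => k.
rewrite /hop_both /pair_config /translate /jump !sub0r.
by case: (x k) => y z; congr pair => /=; rewrite addrA.
Qed.

Lemma hop_secondE i : hop_second i =
  translate (fun k => (0, jump (fun=> 0) i (i + 1) k)).
Proof.
apply/funext => x; apply/funext => k.
rewrite /hop_second /pair_config /translate /jump !sub0r.
by case: (x k) => y z; congr pair => /=; rewrite ?addr0 ?addrA.
Qed.

Lemma hop_both_src i x : hop_both i x i = ((x i).1 - 1, (x i).2 - 1).
Proof. by rewrite /hop_both /pair_config !jump_src. Qed.

Lemma hop_both_dst i x : hop_both i x (i + 1) = ((x (i + 1)).1 + 1, (x (i + 1)).2 + 1).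
Proof. by rewrite /hop_both /pair_config !jump_dst. Qed.

Lemma hop_both_other i x k : k != i -> k != i + 1 -> hop_both i x k = x k.
Proof. by move=> ki kj; rewrite /hop_both /pair_config !jump_other//; case: (x k). Qed.

Lemma hop_second_src i x : hop_second i x i = ((x i).1, (x i).2 - 1).
Proof. by rewrite /hop_second /pair_config jump_src. Qed.

Lemma hop_second_dst i x : hop_second i x (i + 1) = ((x (i + 1)).1, (x (i + 1)).2 + 1).
Proof. by rewrite /hop_second /pair_config jump_dst. Qed.

Lemma hop_second_other i x k : k != i -> k != i + 1 -> hop_second i x k = x k.
Proof. by move=> ki kj; rewrite /hop_second /pair_config jump_other//; case: (x k). Qed.

(** The two sites touched by the jump come first, so that [big_cons] splits their factors off the
    product of masses; the filter keeps the list free of duplicates. *)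
Definition with_edge i (F : seq int) : seq int :=
  [:: i, i + 1 & [seq k <- F | (k != i) && (k != i + 1)]].

Lemma with_edge_uniq i F : uniq F -> uniq (with_edge i F).
Proof.
move=> uF; rewrite /with_edge /= !inE eq_sym succ_neq/= !mem_filter !eqxx/= andbF/=.
exact: filter_uniq.
Qed.

Lemma sub_with_edge i F : {subset F <= with_edge i F}.
Proof.
move=> k kF; rewrite !inE mem_filter kF andbT.
by case: eqP => //=; case: eqP.
Qed.

Lemma notin_with_edge i F k : k \notin with_edge i F -> (k != i) && (k != i + 1).
Proof. by rewrite !inE !negb_or => /and3P[-> ->]. Qed.

End hops.

(** * The generator integrated against a shock measure *)

Section shocks.
Context {R : realType} (g : int -> R) (muhat : R -> int -> int -> R)
  (s : int -> R) (m : int -> int).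
Let p i := pair_mass muhat (s i) (m i).
Let nu := shock_measure muhat s m.
Hypothesis pP : forall i, is_pmf setT (p i).
Hypothesis gM : forall i y, g y * muhat (s i) (m i) y = expR (s i) * muhat (s i) (m i) (y - 1).

Let p0 i x : 0 <= p i x. Proof. by case: (pP i). Qed.
Let nuP : is_product_measure p nu. Proof. exact: product_measureP. Qed.

Let pM i y z : g y * p i (y, z) = expR (s i) * p i (y - 1, z - 1).
Proof.
rewrite /p /pair_mass/= addrAC (inj_eq (addIr _)).
by case: ifPn => _; rewrite ?gM ?mulr0.
Qed.

(** Shifting the pair at [j] by [(-1, -1)] turns the weight [g y * p j] into [expR (s j) * p j] and
    leaves [phi] alone. This yields the independence and the mean of [g] in one step. *)
Lemma integral_rate_out F j (phi : config -> R) : uniq F -> j \notin F -> depends_on F phi ->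
  \int[nu]_x (g (x j).1 * phi x) = \int[nu]_x (expR (s j) * phi x).
Proof.
move=> uF jF Fphi.
have sF : {subset F <= j :: F} by move=> k kF; rewrite inE kF orbT.
apply: (Rintegral_transport p0 p0 nuP nuP (F := j :: F)
  (u := fun i => if i == j then (-1, -1) else 0)) => /=; first by rewrite jF.
- by move=> i; rewrite inE negb_or => /andP[/negPf ->].
- by move=> x y xy; rewrite (depends_on_sub sF Fphi xy) xy// mem_head.
- by move=> x y xy; rewrite (depends_on_sub sF Fphi xy).
have uE i x : i \in F -> translate (fun i => if i == j then (-1, -1) else 0) x i = x i.
  move=> iF; rewrite /translate ifF ?addr0//.
  by apply: contraNF jF => /eqP <-.
move=> x; rewrite !big_cons (Fphi _ _ (fun i => uE i x)).
under [X in _ = _ * (_ * X)]eq_big_seq => i iF do rewrite uE//.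
rewrite {1}/translate eqxx; case: (x j) => y z /=.
rewrite (_ : (y, z) + (-1, -1) = (y - 1, z - 1))//.
by rewrite [LHS]mulrACA pM; ring.
Qed.

(** The same shift, on the single site [j], transports the possibly unbounded rate to a constant. *)
Lemma integrable_rate j : nu.-integrable setT (EFin \o (fun x => g (x j).1)).
Proof.
pose u i : int * int := if i == j then (-1, -1) else 0.
apply: (@integrable_transport _ _ _ _ _ p0 p0 nuP nuP [:: j] u _ _ _ (fun=> expR (s j))) => //=.
- by move=> i; rewrite inE /u => /negPf ->.
- by move=> x y xy; rewrite xy// mem_head.
- move=> x; rewrite !big_seq1 /translate /u eqxx; case: (x j) => y z /=.
  exact: pM.
- exact: finite_measure_integrable_cst.
Qed.

(** The change of variables is the jump itself. Removing a particle at [i] uses up the rate there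
    and gives [expR (s i)]; adding one at [i + 1] produces the rate there and costs
    [expR (s (i + 1))]. *)
Lemma integral_hop_both F i (phi : config -> R) : uniq F -> depends_on F phi ->
  \int[nu]_x (g (x i).1 * phi (hop_both i x)) =
  \int[nu]_x (expR (s i - s (i + 1)) * (g (x (i + 1)).1 * phi x)).
Proof.
move=> uF Fphi; have sF := @sub_with_edge i F.
have Gphi := depends_on_sub sF Fphi.
pose u k : int * int := (jump (fun=> 0) i (i + 1) k, jump (fun=> 0) i (i + 1) k).
have hopE : hop_both i = translate u := hop_bothE i.
rewrite hopE; apply: (Rintegral_transport p0 p0 nuP nuP (F := with_edge i F) (u := u)).
- exact: with_edge_uniq.
- by move=> k /notin_with_edge/andP[ki kj]; rewrite /u jump_other.
- by move=> x y xy; rewrite [X in _ * X](depends_on_translate u Gphi xy) xy// mem_head.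
- move=> x y xy; rewrite [X in _ * (_ * X)](Gphi _ _ xy) xy//.
  by rewrite !inE eqxx orbT.
rewrite -hopE => x; rewrite !big_cons.
under [X in _ = _ * (_ * (_ * X))]eq_big_seq => k.
  rewrite mem_filter => /andP[/andP[ki kj] _].
  rewrite hop_both_other//.
  over.
rewrite hop_both_src hop_both_dst/=.
have := pM i (x i).1 (x i).2; have := pM (i + 1) ((x (i + 1)).1 + 1) ((x (i + 1)).2 + 1).
rewrite !addrK -!surjective_pairing => E1 E2.
set P := \prod_(j <- _) _.
set f := phi _.
transitivity (f * (g (x i).1 * p i (x i)) * p (i + 1) (x (i + 1)) * P); first by ring.
rewrite E2 expRD.
transitivity (f * expR (s i) * expR (- s (i + 1)) * p i ((x i).1 - 1, (x i).2 - 1) *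
  (g ((x (i + 1)).1 + 1) * p (i + 1) ((x (i + 1)).1 + 1, (x (i + 1)).2 + 1)) * P); last by ring.
rewrite E1 expRN; field.
by rewrite gt_eqF ?expR_gt0.
Qed.

(** [A + eps * g y] is the function [h y] of the opening comment; the models take [eps] equal to [1]
    or [-1]. *)
Variables (A eps : R) (K : int -> R).
Hypothesis gD : forall i y, g (y + m i) - g y = K i * (A + eps * g y).
Hypothesis h_ge0 : forall y, 0 <= A + eps * g y.
Hypothesis K0 : forall i, m i = 0 -> K i = 0.

(** The weight [p i x] vanishes unless [x.2 = x.1 + m i], so the identity [gD] applies wherever it
    matters. *)
Let pD i x : (g x.2 - g x.1) * p i x = K i * (A + eps * g x.1) * p i x.
Proof.
rewrite /p /pair_mass; case: eqP => [->|_]; last by rewrite !mulr0.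
by rewrite gD.
Qed.

Let tilted_integrable i : nu.-integrable setT (EFin \o (fun x => A + eps * g (x i).1)).
Proof.
apply: (@integrableD _ _ _ nu setT measurableT (EFin \o cst A)
  (EFin \o (fun x => eps * g (x i).1))).
  exact: finite_measure_integrable_cst.
exact: (@integrableZl _ _ _ nu setT measurableT eps _ (integrable_rate i)).
Qed.

Lemma integrable_second_rate i : nu.-integrable setT (EFin \o (fun x => g (x i).2 - g (x i).1)).
Proof.
apply: (@integrable_transport _ _ _ _ _ p0 p0 nuP nuP [:: i] (fun=> 0) _ _ _
  (fun x => K i * (A + eps * g (x i).1))) => //.
- by move=> x y xy; rewrite xy ?mem_head.
- by move=> x y xy; rewrite xy ?mem_head.
- by move=> x; rewrite translate0 !big_seq1 pD.
- exact: (@integrableZl _ _ _ nu setT measurableT (K i) _ (tilted_integrable i)).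
Qed.

(** Transport along the zero translation: two integrands need only agree after multiplication by the
    weights, that is, on the support of the measure. *)
Lemma integral_second_rate F i (psi : config -> R) : uniq F -> i \in F -> depends_on F psi ->
  \int[nu]_x ((g (x i).2 - g (x i).1) * psi x) =
  \int[nu]_x (K i * ((A + eps * g (x i).1) * psi x)).
Proof.
move=> uF iF Fpsi.
apply: (Rintegral_transport p0 p0 nuP nuP (F := F) (u := fun=> 0)) => //.
- by move=> x y xy; rewrite (Fpsi _ _ xy) xy.
- by move=> x y xy; rewrite (Fpsi _ _ xy) xy.
- move=> x; rewrite translate0 !(bigD1_seq i)//=.
  by rewrite mulrACA pD; ring.
Qed.

Lemma integral_tilted i : \int[nu]_x (A + eps * g (x i).1) = A + eps * expR (s i).
Proof.
rewrite RintegralD//; last 2 first.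
- exact: finite_measure_integrable_cst.
- exact: (@integrableZl _ _ _ nu setT measurableT eps _ (integrable_rate i)).
rewrite RintegralZl//; last exact: integrable_rate.
rewrite Rintegral_probability_cst; congr (_ + _ * _).
under eq_Rintegral do rewrite -[g _]mulr1.
rewrite (@integral_rate_out [::] i (cst 1))//=.
by under eq_Rintegral do rewrite mulr1; exact: Rintegral_probability_cst.
Qed.

(** As the mean of the nonnegative [h], this makes the jump rate of the shocks nonnegative in all
    cases at once. *)
Lemma tilted_mean_ge0 i : 0 <= A + eps * expR (s i).
Proof. by rewrite -integral_tilted; exact: Rintegral_ge0. Qed.

Variable sr : int -> int -> R.
Hypothesis sr_other : forall i j, j != i -> sr i j = s j.
Let p' i j := pair_mass muhat (sr i j) (jump m i (i + 1) j).
Let nu' i := shock_measure muhat (sr i) (jump m i (i + 1)).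
(* When [m i = 0], the vector [jump m i (i + 1)] is negative at [i] and [nu' i] is a
   junk measure, but then [K i = 0]. *)
Hypothesis p'P : forall i, m i != 0 -> forall j, is_pmf setT (p' i j).
Hypothesis tilt : forall i, m i != 0 -> exists C, forall y,
  (A + eps * g y) * muhat (s i) (m i) y = C * muhat (sr i i) (m i - 1) y.
Hypothesis muhatS : forall i y, muhat (s i) (m i + 1) y = muhat (s i) (m i) y.

(** On the support the rate is [K i * h]. The density [h] changes the parameter at [i] to [sr i i],
    while the translation carries one second class particle to [i + 1]; together they turn [nu] into
    [nu' i] up to a constant. *)
Lemma integral_hop_second F i (phi : config -> R) :
  uniq F -> depends_on F phi -> bounded_function phi ->
  \int[nu]_x ((g (x i).2 - g (x i).1) * phi (hop_second i x)) =
  K i * (A + eps * expR (s i)) * \int[nu' i]_x phi x.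
Proof.
move=> uF Fphi phib.
have hopE : hop_second i = translate (fun k => (0, jump (fun=> 0) i (i + 1) k)) := hop_secondE i.
have hop_dep G (f : config -> R) : depends_on G f -> depends_on G (f \o hop_second i).
  by move=> Gf; rewrite hopE; exact: depends_on_translate.
have hop_bd (f : config -> R) : bounded_function f -> bounded_function (f \o hop_second i).
  by move=> [M fM]; exists M => x; exact: fM.
have iF : i \in with_edge i F by rewrite mem_head.
have Gphi := hop_dep _ _ (depends_on_sub (@sub_with_edge i F) Fphi).
rewrite (@integral_second_rate (with_edge i F) i (phi \o hop_second i))//; last exact: with_edge_uniq.
have Hi := integrable_mul_bounded Gphi (hop_bd _ phib) (tilted_integrable i).
rewrite RintegralZl// -mulrA.
have [/K0->|mi0] := eqVneq (m i) 0; first by rewrite !mul0r.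
congr (_ * _).
have [C CE] := tilt mi0.
have p'0 j x : 0 <= p' i j x by case: (p'P mi0 j).
have nu'P : is_product_measure (p' i) (nu' i) by apply: product_measureP; exact: p'P.
have key G (f : config -> R) : uniq G -> depends_on G f -> bounded_function f ->
    \int[nu]_x ((A + eps * g (x i).1) * f (hop_second i x)) = C * \int[nu' i]_x f x.
  move=> uG Gf fb; rewrite -RintegralZl//; last exact: bounded_depends_integrable Gf fb.
  have Gf' := depends_on_sub (@sub_with_edge i G) Gf.
  rewrite hopE.
  apply: (Rintegral_transport p0 p'0 nuP nu'P (F := with_edge i G)
    (u := fun k => (0, jump (fun=> 0) i (i + 1) k))).
  - exact: with_edge_uniq.
  - by move=> k /notin_with_edge/andP[ki kj]; rewrite jump_other.
  - by move=> x y xy; rewrite -hopE [X in _ * X](hop_dep _ _ Gf' _ _ xy) xy// mem_head.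
  - by move=> x y xy; rewrite (Gf' _ _ xy).
  rewrite -hopE => x; rewrite !big_cons.
  under [X in _ = _ * (_ * (_ * X))]eq_big_seq => k.
    rewrite mem_filter => /andP[/andP[ki kj] _].
    rewrite hop_second_other// /p' sr_other// jump_other// -/(p k (x k)).
    over.
  rewrite hop_second_src hop_second_dst.
  have -> : p' i (i + 1) ((x (i + 1)).1, (x (i + 1)).2 + 1) = p (i + 1) (x (i + 1)).
    rewrite /p' /p sr_other ?succ_neq// jump_dst /pair_mass/= addrA (inj_eq (addIr _)).
    by rewrite muhatS.
  have E : (A + eps * g (x i).1) * p i (x i) = C * p' i i ((x i).1, (x i).2 - 1).
    rewrite /p' /p jump_src /pair_mass/= addrA (inj_eq (addIr _)).
    by case: ifP => _; rewrite ?mulr0// CE.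
  by rewrite mulrACA E; ring.
rewrite (key F)//; congr (_ * _).
(* The constant function [1] identifies [C] as the mean of [A + eps * g (w i)]. *)
have := key [::] (cst 1).
rewrite Rintegral_probability_cst mulr1 => <- //.
  by under eq_Rintegral do rewrite mulr1; exact: integral_tilted.
by exists 1 => x; rewrite /= normr1.
Qed.

Let generator_term phi i x := g (x i).1 * (phi (hop_both i x) - phi x) +
  (g (x i).2 - g (x i).1) * (phi (hop_second i x) - phi x).

(** Only the integrals of [phi] under [nu] and [nu' i], and those of [g (w i) * phi] and
    [g (w (i + 1)) * phi], remain; in this form the sum over sites can telescope. The four products
    are integrable separately, which permits the splitting. *)
Lemma integral_generator_term F i (phi : config -> R) :
  uniq F -> depends_on F phi -> bounded_function phi ->
  nu.-integrable setT (EFin \o generator_term phi i) /\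
  \int[nu]_x generator_term phi i x =
    expR (s i - s (i + 1)) * (\int[nu]_x (g (x (i + 1)).1 * phi x)) -
    \int[nu]_x (g (x i).1 * phi x) +
    (K i * (A + eps * expR (s i)) * \int[nu' i]_x phi x -
     K i * (A * \int[nu]_x phi x + eps * \int[nu]_x (g (x i).1 * phi x))).
Proof.
move=> uF Fphi phib.
have bd f : bounded_function (phi \o f) by case: phib => M fM; exists M => x; exact: fM.
have bi := @integrable_mul_bounded _ nu F.
have i1 : nu.-integrable setT (EFin \o (fun x => g (x i).1 * phi (hop_both i x))).
  apply: bi (bd _) (integrable_rate i); rewrite hop_bothE; exact: depends_on_translate.
have i2 := bi _ _ Fphi phib (integrable_rate i).
have i2' := bi _ _ Fphi phib (integrable_rate (i + 1)).
have i3 : nu.-integrable setT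
    (EFin \o (fun x => (g (x i).2 - g (x i).1) * phi (hop_second i x))).
  apply: bi (bd _) (integrable_second_rate i); rewrite hop_secondE; exact: depends_on_translate.
have i4 := bi _ _ Fphi phib (integrable_second_rate i).
have i5 := bounded_depends_integrable nu Fphi phib.
have i12 := @integrableB _ _ _ nu setT measurableT _ _ i1 i2.
have i34 := @integrableB _ _ _ nu setT measurableT _ _ i3 i4.
have termE : generator_term phi i = (fun x =>
    (g (x i).1 * phi (hop_both i x) - g (x i).1 * phi x) +
    ((g (x i).2 - g (x i).1) * phi (hop_second i x) - (g (x i).2 - g (x i).1) * phi x)).
  by apply/funext => x; rewrite /generator_term !mulrBr.
rewrite termE; split; first exact: (@integrableD _ _ _ nu setT measurableT _ _ i12 i34).
rewrite RintegralD// !RintegralB//.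
congr (_ - _ + (_ - _)).
- by rewrite (integral_hop_both i uF)// RintegralZl.
- exact: (@integral_hop_second F).
- have i6 : nu.-integrable setT (EFin \o (fun x => A * phi x)).
    exact: (@integrableZl _ _ _ nu setT measurableT A _ i5).
  have i7 : nu.-integrable setT (EFin \o (fun x => eps * (g (x i).1 * phi x))).
    exact: (@integrableZl _ _ _ nu setT measurableT eps _ i2).
  rewrite (@integral_second_rate (with_edge i F)) ?with_edge_uniq ?mem_head//; last first.
    exact: depends_on_sub (@sub_with_edge i F) Fphi.
  rewrite RintegralZl//; last exact: bi (tilted_integrable i).
  congr (_ * _); rewrite -!RintegralZl// -RintegralD//.
  by apply: eq_Rintegral => x _; rewrite mulrDl mulrA.
Qed.

(** The two measures have the same marginals at all sites other than [i] and [i + 1]. *)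
Lemma integral_unchanged F i (phi : config -> R) : uniq F -> depends_on F phi ->
  i \notin F -> i + 1 \notin F -> m i != 0 ->
  \int[nu' i]_x phi x = \int[nu]_x phi x.
Proof.
move=> uF Fphi iF jF mi0.
have p'0 j x : 0 <= p' i j x by case: (p'P mi0 j).
have nu'P : is_product_measure (p' i) (nu' i) by apply: product_measureP; exact: p'P.
apply: (Rintegral_transport p'0 p0 nu'P nuP (F := F) (u := fun=> 0)) => // x.
rewrite translate0; congr (_ * _); apply: eq_big_seq => k kF.
have ki : k != i by apply: contraNneq iF => <-.
have kj : k != i + 1 by apply: contraNneq jF => <-.
by rewrite /p' sr_other// jump_other.
Qed.

Hypothesis K_ge0 : forall i, 0 <= K i.
(** Site [i] contributes [g (w i) * phi] with coefficient [-(1 + eps * K i)] from its own term and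
    [expR (s (i - 1) - s i)] from the term of [i - 1]; this condition cancels them. *)
Hypothesis KE : forall i, 1 + eps * K i = expR (s (i - 1) - s i).

Lemma random_walking_shocksP (P : int -> int -> R -> R -> R) (sl : int -> int -> R) :
  (forall i, P (m i) (m (i + 1)) (s i) (s (i + 1)) = K i * (A + eps * expR (s i))) ->
  random_walking_shocks g (shock_measure muhat) s m P (fun _ _ _ _ => 0) sr sl.
Proof.
move=> PE; split=> // [i|phi phib [F0 F0phi]].
  by rewrite PE mulr_ge0// tilted_mean_ge0.
pose F := undup F0.
have uF : uniq F by exact: undup_uniq.
have Fphi : depends_on F phi by apply: depends_on_sub F0phi => i; rewrite mem_undup.
pose N := \max_(i <- F) `|i|%N.
have FN i : i \in F -> - N%:Z <= i <= N%:Z.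
  by move=> iF; rewrite -ler_norml -abszE lez_nat; exact: leq_bigmax_seq.
(* The window [W] runs from [-N - 1] to [N]: one site more on the left, since the term of [i] also
   involves [i + 1]. *)
pose site k : int := k%:Z - (N%:Z + 1).
pose W := map site (index_iota 0 (N + N).+2).
have uW : uniq W by rewrite map_inj_uniq ?iota_uniq// => k l /addIr[].
have outW i : i \notin W -> (i \notin F) && (i + 1 \notin F).
  apply: contraNT; rewrite negb_and !negbK => iF.
  have iN : - N%:Z - 1 <= i <= N%:Z.
    by case/orP: iF => /FN /andP[? ?]; apply/andP; split; lia.
  apply/mapP; exists (absz (i + (N%:Z + 1))); first by rewrite mem_index_iota; lia.
  by rewrite /site; lia.
have fsumW (f : int -> R) : (forall i, i \notin W -> f i = 0) ->
    \sum_(i \in [set: int]) f i = \sum_(i <- W) f i.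
  move=> f0; rewrite (fsbigE W)//; last by move=> i _; exact: f0.
  by apply: eq_bigl => i; rewrite in_setT.
have termW x i : i \notin W -> generator_term phi i x = 0.
  move=> /outW/andP[iF jF].
  have out k : k \in F -> (k != i) && (k != i + 1).
    by move=> kF; apply/andP; split; [apply: contraNneq iF|apply: contraNneq jF] => <-.
  rewrite /generator_term (Fphi (hop_both i x) x); last first.
    by move=> k /out/andP[ki kj]; rewrite hop_both_other.
  rewrite (Fphi (hop_second i x) x); last first.
    by move=> k /out/andP[ki kj]; rewrite hop_second_other.
  by rewrite !subrr !mulr0 addr0.
have genE x : generator g phi x = \sum_(i <- W) generator_term phi i x.
  by rewrite -fsumW// => i; exact: termW.
have intT i := integral_generator_term i uF Fphi phib.
under eq_integral do rewrite genE -sumEFin.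
rewrite integral_sum//; last by move=> i; exact: (intT i).1.
transitivity (\sum_(i <- W) (\int[nu]_x generator_term phi i x)%:E)%E.
  apply: eq_bigr => i _; rewrite fineK//.
  exact: (integrable_fin_num _ (intT i).1).
(* Outside the window the shock terms vanish as well: either [m i = 0] and the rate is zero, or
   [phi] sees neither of the two changed sites. *)
rewrite sumEFin; congr EFin; rewrite fsumW; last first.
  move=> i /outW/andP[iF jF]; rewrite mul0r addr0 PE.
  have [/K0->|mi0] := eqVneq (m i) 0; first by rewrite !mul0r.
  by rewrite (integral_unchanged uF)// subrr mulr0.
apply/eqP; rewrite -subr_eq0 -sumrB; apply/eqP.
(* The potential whose increments are the differences between the two sides, site by site. *)
pose G i := expR (s (i - 1) - s i) * (\int[nu]_x (g (x i).1 * phi x)) -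
  expR (s (i - 1)) * \int[nu]_x phi x.
have GF i : i \notin F -> G i = 0.
  move=> iF; rewrite /G (integral_rate_out uF iF Fphi) RintegralZl//; last first.
    exact: bounded_depends_integrable Fphi phib.
  by rewrite mulrA -expRD subrK subrr.
rewrite big_map (eq_bigr (fun k => G (site k.+1) - G (site k))); last first.
  move=> k _; have -> : site k.+1 = site k + 1 by rewrite /site; lia.
  move: (site k) => {k}i; rewrite (intT i).2 PE mul0r addr0 /G addrK.
  (* Expressing everything through [K i] and [expR (s i)] leaves a polynomial identity. *)
  have -> : expR (s (i - 1)) = (1 + eps * K i) * expR (s i) by rewrite KE -expRD subrK.
  by rewrite -KE -/nu -/(nu' i); ring.
(* The end points are [-N - 1] and [N + 1], both outside [F]. *)
rewrite telescope_sumr// !GF ?subrr//; apply/negP => /FN; rewrite /site; lia.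
Qed.

End shocks.

(** * One-site marginals *)

(** The mass sits on the image of [I] under the injection of [y] to [(y, y + k)]. *)
Lemma pair_mass_pmf (R : realType) (I : set int) (muhat : R -> int -> int -> R) t k :
  is_pmf I (muhat t k) -> is_pmf setT (pair_mass muhat t k).
Proof.
move=> [mu0 muI mu1]; split=> [[y z]|z []//|]; first by rewrite /pair_mass; case: ifP.
pose e y : int * int := (y, y + k).
transitivity (\esum_(yz in e @` I) (pair_mass muhat t k yz)%:E)%E.
  rewrite [RHS]esum_mkcond; apply: eq_esum => -[y z] _.
  case: ifPn => // /negP; rewrite inE => nyz.
  rewrite /pair_mass/=; case: eqP => // zE; rewrite muI// => Iy; apply: nyz.
  by exists y => //; rewrite /e zE.
rewrite esum_image; last by move=> y z _ _ [].
by rewrite -mu1; apply: eq_esum => y _; rewrite /pair_mass/= eqxx.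
Qed.

Section stationary_mass.
Context {R : realType} (I : set int) (g : int -> R).

(** One recursion covers both branches of [gfact]. For [y <= 0] the factor [g y] is inverted in
    [gfact g (y - 1)], whence the hypothesis. *)
Lemma gfact_pred y : g y != 0 -> gfact g y = gfact g (y - 1) * g y.
Proof.
case: y => [[|n]|n] gy.
- by rewrite /= big_nat1 big_nil oppr0 mulVf.
- by rewrite (_ : n.+1%:Z - 1 = n%:Z); [rewrite /= big_nat_recr|lia].
- rewrite (_ : Negz n - 1 = Negz n.+1); last lia.
  have -> : g (Negz n) = g (- n.+1%:Z) by rewrite -NegzE.
  rewrite NegzE in gy.
  by rewrite /= [in RHS]big_nat_recr//= invfM -mulrA mulVf// mulr1.
Qed.

(** Inside [I] this is the recursion of [gfact]. At a lower end of [I] both sides vanish: the left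
    because [g] does, the right because [y - 1] lies outside [I]. *)
Lemma stationary_mass_rate t y :
  (forall z, I (z - 1) -> I z /\ g z != 0) -> (forall z, I z -> ~ I (z - 1) -> g z = 0) ->
  g y * stationary_mass I g t y = expR t * stationary_mass I g t (y - 1).
Proof.
move=> g_neq0 g_eq0; rewrite /stationary_mass.
have [Iy1|nIy1] := pselect (I (y - 1)).
  have [Iy gy] := g_neq0 _ Iy1.
  rewrite !mem_set// /weight [gfact g y]gfact_pred// invfM.
  rewrite (_ : t * y%:~R = t + t * (y - 1)%:~R); last by rewrite intrB; ring.
  rewrite expRD; set W := expR (_ * _); set X := (gfact g (y - 1))^-1.
  set Z := (partition_function _ _ _)^-1.
  by transitivity (g y / g y * (expR t * W * X * Z)); [ring|rewrite divff//; ring].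
rewrite (memNset nIy1) mulr0; have [Iy|nIy] := pselect (I y).
  by rewrite g_eq0// mul0r.
by rewrite (memNset nIy) mulr0.
Qed.

(** No series is estimated: a zero value, including the default of [fine] at infinity, would make
    all masses [x / 0 = 0], against total mass 1. *)
Lemma partition_function_neq0 t :
  is_pmf I (stationary_mass I g t) -> partition_function I g t != 0.
Proof.
move=> [_ _ mass1]; apply/eqP => Z0; move: mass1.
rewrite esum1; first by move/eqP; rewrite eq_sym onee_eq0.
by move=> z _; rewrite /stationary_mass Z0 invr0 mulr0 if_same.
Qed.

Lemma stationary_mass_tilt t d y : partition_function I g (t + d) != 0 ->
  expR (d * y%:~R) * stationary_mass I g t y =
  partition_function I g (t + d) / partition_function I g t * stationary_mass I g (t + d) y.
Proof.
move=> Z0; rewrite /stationary_mass; case: ifP => _; last by rewrite !mulr0.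
rewrite /weight mulrDl expRD; set Z' := partition_function I g (t + d) in Z0 *.
set X := (gfact g y)^-1; set Z := (partition_function I g t)^-1.
transitivity (Z' / Z' * (expR (d * y%:~R) * expR (t * y%:~R) * X * Z)); last by ring.
by rewrite divff//; ring.
Qed.

End stationary_mass.

(** * The three families of rates *)

Section rates.
Context {R : realType} (c : zrp_case) (a b beta : R).
Hypotheses (a0 : 0 < a) (b0 : 0 <= b) (beta0 : 0 < beta).
Let g := rate c a b beta.
Let I := occupation c.

(* With [h y = a e^(tilt_step * y)], one has [h y = rate_shift + rate_slope * g y] and
   [g (y + k) - g y = rate_growth k * h y]. *)
Definition tilt_step : R := if c is concave_exp then - beta else beta.
Definition rate_slope : R := if c is concave_exp then -1 else 1.
Definition rate_shift : R := if c is two_sided_exp then - b else a.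
Definition rate_growth (k : int) : R :=
  if c is concave_exp then 1 - expR (- (beta * k%:~R)) else expR (beta * k%:~R) - 1.

Lemma rate_tiltE y : rate_shift + rate_slope * g y = a * expR (tilt_step * y%:~R).
Proof. by rewrite /rate_shift /rate_slope /g /rate /tilt_step; case: c; rewrite ?mulNr; ring. Qed.

Lemma sigma_right_src (s : int -> R) i : sigma_right c beta s i i = s i + tilt_step.
Proof. by rewrite /sigma_right eqxx /tilt_step; case: c. Qed.

Lemma shock_rateE k l t u :
  shock_rate c a b beta k l t u = rate_growth k * (rate_shift + rate_slope * expR t).
Proof. by rewrite /shock_rate /rate_growth /rate_shift /rate_slope; case: c; ring. Qed.

Lemma rate_tilt_ge0 y : 0 <= rate_shift + rate_slope * g y.
Proof. by rewrite rate_tiltE mulr_ge0 ?expR_ge0// ltW. Qed.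

Lemma rateD k y : g (y + k) - g y = rate_growth k * (rate_shift + rate_slope * g y).
Proof.
rewrite rate_tiltE /rate_growth /g /rate /tilt_step.
by case: c; rewrite intrD ?mulNr [beta * (_ + _)]mulrDr ?opprD expRD; ring.
Qed.

Lemma rate_growth_ge0 k : 0 <= k -> 0 <= rate_growth k.
Proof.
move=> k0; have bk : 0 <= beta * k%:~R by rewrite mulr_ge0 ?ler0z// ltW.
by rewrite /rate_growth; case: c; rewrite subr_ge0 ?expR_le1 ?oppr_le0// leNgt expR_lt1 -leNgt.
Qed.

Lemma rate_growth0 : rate_growth 0 = 0.
Proof. by rewrite /rate_growth; case: c; rewrite mulr0 ?oppr0 expR0 subrr. Qed.

(** Turns the prescribed increments of the parameters into the telescoping condition [KE]. *)
Lemma rate_growthE k : 1 + rate_slope * rate_growth k = expR (sigma_increment c beta k).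
Proof. by rewrite /rate_slope /rate_growth /sigma_increment; case: c; ring. Qed.

Lemma rate_neq0 z : I (z - 1) -> I z /\ g z != 0.
Proof.
rewrite /I /g /occupation /rate; case: c => /= [z1|z1|_].
- have z0 : 0 < z by lia.
  split; first exact: ltW.
  by rewrite mulf_neq0 ?gt_eqF// subr_gt0 expR_lt1 oppr_lt0 mulr_gt0 ?ltr0z.
- have z0 : 0 < z by lia.
  split; first exact: ltW.
  by rewrite mulf_neq0 ?gt_eqF// subr_gt0 expR_gt1 mulr_gt0 ?ltr0z.
- by split=> //; rewrite gt_eqF// ltr_wpDr// mulr_gt0// expR_gt0.
Qed.

Lemma rate_eq0 z : I z -> ~ I (z - 1) -> g z = 0.
Proof.
rewrite /I /g /occupation /rate; case: c => /= [z0 z1|z0 z1|_ []//].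
- have -> : z = 0 by lia.
  by rewrite mulr0 oppr0 expR0 subrr mulr0.
- have -> : z = 0 by lia.
  by rewrite mulr0 expR0 subrr mulr0.
Qed.

(** By [1 + x <= e^x] the rate grows at least linearly, so its logarithm is unbounded. *)
Lemma theta_sup_oo : c <> concave_exp -> theta_sup g = +oo%E.
Proof.
move=> nc; apply/cvg_lim => //; apply/cvgeyPge => M.
have rate_ge n : a * (beta * n%:R) <= g n%:Z.
  rewrite /g /rate; case: c nc => // _.
    by rewrite ler_wpM2l ?(ltW a0)// lerBrDl expR_ge1Dx.
  rewrite ler_wpDr// ler_wpM2l ?(ltW a0)// (le_trans _ (expR_ge1Dx _))//.
  by rewrite lerDr.
near=> n; rewrite lee_fin -[M]expRK.
have Mn : expR M <= g n%:Z.
  apply: le_trans (rate_ge n); rewrite mulrA mulrC -ler_pdivrMr ?mulr_gt0//.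
  by near: n; exact: nbhs_infty_ger.
by rewrite ler_ln ?posrE ?expR_gt0// (lt_le_trans _ Mn) ?expR_gt0.
Unshelve. all: by end_near.
Qed.

(** The tilt moves the parameter towards an infinite bound: down in the concave case, where
    [theta_inf] is [-oo], and up otherwise, where [theta_sup] is [+oo]. *)
Lemma admissible_tilt t : admissible I g t -> admissible I g (t + tilt_step).
Proof.
rewrite /admissible => /andP[lt_t t_lt].
have [ic|nc] := pselect (c = concave_exp).
  apply/andP; split.
    rewrite /theta_inf asboolF ?ltNyr// => IT.
    have : I (-1) by rewrite IT.
    by rewrite /I ic.
  apply: le_lt_trans t_lt; rewrite lee_fin /tilt_step ic.
  by rewrite gerDl oppr_le0 ltW.
rewrite theta_sup_oo// ltry andbT (lt_le_trans lt_t)// lee_fin /tilt_step.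
by case: c nc => // _; rewrite lerDl ltW.
Qed.

End rates.

(** * Verification of the general conditions in the three cases *)

Theorem theorem3p2 (R : realType) (c : zrp_case) (a b beta : R)
    (m : int -> int) (s : int -> R) (muhat : R -> int -> int -> R)
    (sl : int -> int -> R)
    (ha : 0 < a) (hb : 0 <= b) (hbeta : 0 < beta)
    (hm : forall i, 0 <= m i)
    (hs : forall i, admissible (occupation c) (rate c a b beta) (s i))
    (hinc : forall i, s (i - 1) - s i = sigma_increment c beta (m i))
    (hmuhat : shock_marginals (occupation c) (rate c a b beta) muhat)
    (hmu : forall (t : R) (k : int),
      admissible (occupation c) (rate c a b beta) t -> 0 <= k ->
      forall z, muhat t k z = stationary_mass (occupation c) (rate c a b beta) t z) :
  random_walking_shocks (rate c a b beta) (shock_measure muhat) s m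
    (shock_rate c a b beta) (fun _ _ _ _ => 0)
    (sigma_right c beta s) sl.
Proof.
set g := rate c a b beta; set I := occupation c.
have muP t k : admissible I g t -> 0 <= k -> is_pmf I (muhat t k).
  by move=> tadm k0; exact: (hmuhat t tadm).1.
(* Only site [i] loses a second class particle, and there [m i] is at least 1. *)
have jump_ge0 i : m i != 0 -> forall j, 0 <= jump m i (i + 1) j.
  move=> mi0 j; have := hm j; rewrite /jump; case: eqP => [->|_]; case: eqP => _ //=; lia.
have sr_adm i j : admissible I g (sigma_right c beta s i j).
  have [->|/negPf ji] := eqVneq j i; last by rewrite /sigma_right ji.
  by rewrite sigma_right_src; exact: admissible_tilt.
apply: (@random_walking_shocksP _ g muhat s m _ _ (rate_shift c a b) (rate_slope c)
  (fun i => rate_growth c beta (m i))).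
- by move=> i; exact/pair_mass_pmf/muP.
- move=> i y; rewrite !hmu//; apply: stationary_mass_rate => z.
    exact: rate_neq0.
  exact: rate_eq0.
- by move=> i y; exact: rateD.
- by move=> y; exact: rate_tilt_ge0.
- by move=> i ->; exact: rate_growth0.
- by move=> i j /negPf ji; rewrite /sigma_right ji.
- by move=> i mi0 j; apply: pair_mass_pmf; apply: muP => //; exact: jump_ge0.
- move=> i mi0.
  have mi1 : 0 <= m i - 1 by have := hm i; lia.
  have adm := sr_adm i i; rewrite sigma_right_src in adm.
  have Z0 : partition_function I g (s i + tilt_step c beta) != 0.
    apply: partition_function_neq0.
    (* The shifted parameter is admissible, so the stationary masses there sum to 1. *)
    rewrite (_ : stationary_mass _ _ _ = muhat (s i + tilt_step c beta) 0); first exact: muP.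
    by apply/funext => z; rewrite hmu.
  (* Multiplying by [expR (tilt_step * y)] changes only the normalisation, hence the ratio of
     partition functions; [a] is the prefactor of [h]. *)
  exists (a * (partition_function I g (s i + tilt_step c beta) / partition_function I g (s i))).
  by move=> y; rewrite rate_tiltE sigma_right_src !hmu// -mulrA stationary_mass_tilt// mulrA.
- by move=> i y; rewrite !hmu// addr_ge0.
- by move=> i; exact: rate_growth_ge0.
- by move=> i; rewrite rate_growthE hinc.
- by move=> i; exact: shock_rateE.
Qed.
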